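(* Let $n\ge 1$ be an integer. There exists a universal $C^*$-algebra generated by elements $z_{i,j}$, $1\le i,j\le n+1$, satisfying the following relations (all indices range over $\{1,\dots,n+1\}$): (1) $z_{i,j}z_{i,l}=0$ if $j<l$; (2) $z_{i,j}z_{k,j}=0$ if $i<k$; (3) $z_{i,l}z_{k,j}-z_{k,j}z_{i,l}=0$ if $i<k$ and $j<l$; (4) $z_{i,l}z_{k,j}=0$ if $i<k$, $j<l$ and $\max\{i,j\}\ge \min\{k,l\}$; (5) $z_{i,j}z_{k,l}-z_{k,l}z_{i,j}=0$ if $i<k$, $j<l$ and $\max\{i,j\}+1<\min\{k,l\}$; (6) $z_{i,j}z_{k,l}-z_{k,l}z_{i,j}=z_{i,l}z_{k,j}$ if $i<k$, $j<l$ and $\max\{i,j\}+1=\min\{k,l\}$; (7) $z_{1,1}z_{2,2}\cdots z_{n+1,n+1}=1$; (8) $$z_{r,s}^*=\begin{cases}(z_{1,1}\cdots z_{s-1,s-1})(z_{s,s+1}z_{s+1,s+2}\cdots z_{r-1,r})(z_{r+1,r+1}\cdots z_{n+1,n+1}) & \text{if } r>s,\\ (z_{1,1}\cdots z_{r-1,r-1})(z_{r+1,r}z_{r+2,r+1}\cdots z_{s,s-1})(z_{s+1,s+1}\cdots z_{n+1,n+1}) & \text{if } r<s,\\ (z_{1,1}\cdots z_{s-1,s-1})(z_{s+1,s+1}z_{s+2,s+2}\cdots z_{n+1,n+1}) & \text{if } r=s;\end{cases}$$ (9) $z_{i,j}^*z_{r,s}=z_{r,s}z_{i,j}^*$ if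 $i\ne r$ and $j\ne s$.
   Context: A universal $C^*$-algebra for a set of generators and relations is a unital $C^*$-algebra $A$ generated by elements $z_{i,j}$ satisfying the relations, such that for every unital $C^*$-algebra $B$ and every family of elements $b_{i,j}\in B$ satisfying the same relations there is a unique unital $*$-homomorphism $A\to B$ with $z_{i,j}\mapsto b_{i,j}$. Empty products are equal to $1$. In the paper the resulting $C^*$-algebra is denoted $A_n(0)$ and is called the crystallization of $A_n(q)=C(SU_q(n+1))$. *)

(* Defs.v *)
From HB Require Import structures.
From mathcomp Require Import all_boot all_order all_algebra.
From mathcomp Require Import complex.
From mathcomp Require Import all_classical all_reals all_analysis.

Set Implicit Arguments.
Unset Strict Implicit.
Unset Printing Implicit Defensive.

Import Order.TTheory GRing.Theory Num.Theory.
Import numFieldNormedType.Exports.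

Local Open Scope classical_set_scope.
Local Open Scope ring_scope.
Local Open Scope complex_scope.

(* A hierarchy structure joining a normed module and a ring would have to be   *)
(* declared before numDomainType, so the algebra is a plain record over a      *)
(* complete normed module, whose carrier then gets its ring structure. It is a *)
(* pzRingType rather than an algType because algType requires 1 != 0 and the   *)
(* zero algebra is a unital C*-algebra. As for every normed module over R[i],  *)
(* the norm takes its values in the nonnegative reals of R[i].                 *)
Record cstarAlgType (R : realType) := CStarAlgebra {
  cstar_mod : completeNormedModType R[i];
  cstar_one : cstar_mod;
  cstar_mul : cstar_mod -> cstar_mod -> cstar_mod;
  cstar_adj : cstar_mod -> cstar_mod;
  cstar_mulA : associative cstar_mul;
  cstar_mul1x : left_id cstar_one cstar_mul;
  cstar_mulx1 : right_id cstar_one cstar_mul;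
  cstar_mulDl : left_distributive cstar_mul +%R;
  cstar_mulDr : right_distributive cstar_mul +%R;
  cstar_scaleAl : forall (a : R[i]) x y,
    a *: cstar_mul x y = cstar_mul (a *: x) y;
  cstar_scaleAr : forall (a : R[i]) x y,
    a *: cstar_mul x y = cstar_mul x (a *: y);
  cstar_normM : forall x y, `|cstar_mul x y| <= `|x| * `|y|;
  cstar_adjD : {morph cstar_adj : x y / x + y};
  cstar_adjZ : forall (a : R[i]) x, cstar_adj (a *: x) = a^* *: cstar_adj x;
  cstar_adjM : forall x y,
    cstar_adj (cstar_mul x y) = cstar_mul (cstar_adj y) (cstar_adj x);
  cstar_adjK : involutive cstar_adj;
  cstar_norm : forall x, `|cstar_mul (cstar_adj x) x| = `|x| ^+ 2
}.

Definition cstar_sort (R : realType) (A : cstarAlgType R) : Type :=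
  cstar_mod A.
Coercion cstar_sort : cstarAlgType >-> Sortclass.

HB.instance Definition _ (R : realType) (A : cstarAlgType R) :=
  CompleteNormedModule.copy (cstar_sort A) (cstar_mod A).
HB.instance Definition _ (R : realType) (A : cstarAlgType R) :=
  GRing.Zmodule_isPzRing.Build (cstar_sort A)
    (@cstar_mulA R A) (@cstar_mul1x R A) (@cstar_mulx1 R A)
    (@cstar_mulDl R A) (@cstar_mulDr R A).

Definition star (R : realType) (A : cstarAlgType R) (x : A) : A :=
  cstar_adj x.

Section Universal.
Context {R : realType}.

Definition unital_star_hom (A B : cstarAlgType R) (phi : A -> B) : Prop :=
  [/\ linear phi, GRing.monoid_morphism phi & {morph phi : x / star x}].

Record unital_cstar_subalgebra (A : cstarAlgType R) (S : set A) : Prop := {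
  subcstar_closed : closed S;
  subcstar_1 : S 1;
  subcstar_D : forall x y, S x -> S y -> S (x + y);
  subcstar_Z : forall (a : R[i]) x, S x -> S (a *: x);
  subcstar_M : forall x y, S x -> S y -> S (x * y);
  subcstar_star : forall x, S x -> S (star x)
}.

Definition generates (I : Type) (A : cstarAlgType R) (z : I -> A) : Prop :=
  forall S : set A, unital_cstar_subalgebra S -> (forall i, S (z i)) ->
    S = setT.

Record universal_cstar_algebra (I : Type)
    (rel : forall B : cstarAlgType R, (I -> B) -> Prop)
    (A : cstarAlgType R) (z : I -> A) : Prop := {
  universal_rel : rel A z;
  universal_gen : generates z;
  universal_hom : forall (B : cstarAlgType R) (b : I -> B), rel B b ->
    exists! phi : A -> B, unital_star_hom phi /\ forall i, phi (z i) = b i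
}.

(* Rows and columns are numbered from 0, so 'I_n.+1 stands for {1, ..., n+1}.  *)
(* The arguments of inord below are always at most n, so that inord is exact:  *)
(* \prod_(s <= t < r) z (inord t, inord t.+1) is the product                   *)
(* z_{s,s+1} z_{s+1,s+2} ... z_{r-1,r}. All products are taken in increasing   *)
(* order of the index.                                                         *)
Record crystal_relations (n : nat) (B : cstarAlgType R)
    (z : 'I_n.+1 * 'I_n.+1 -> B) : Prop := {
  crystal_row : forall i j l : 'I_n.+1, (j < l)%N -> z (i, j) * z (i, l) = 0;
  crystal_col : forall i j k : 'I_n.+1, (i < k)%N -> z (i, j) * z (k, j) = 0;
  crystal_anti_comm : forall i j k l : 'I_n.+1, (i < k)%N -> (j < l)%N ->
    z (i, l) * z (k, j) - z (k, j) * z (i, l) = 0;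
  crystal_anti_zero : forall i j k l : 'I_n.+1, (i < k)%N -> (j < l)%N ->
    (maxn i j >= minn k l)%N -> z (i, l) * z (k, j) = 0;
  crystal_main_comm : forall i j k l : 'I_n.+1, (i < k)%N -> (j < l)%N ->
    ((maxn i j).+1 < minn k l)%N ->
    z (i, j) * z (k, l) - z (k, l) * z (i, j) = 0;
  crystal_main_bracket : forall i j k l : 'I_n.+1, (i < k)%N -> (j < l)%N ->
    (maxn i j).+1 = minn k l ->
    z (i, j) * z (k, l) - z (k, l) * z (i, j) = z (i, l) * z (k, j);
  crystal_det : \prod_(t < n.+1) z (t, t) = 1;
  crystal_star_lower : forall r s : 'I_n.+1, (s < r)%N ->
    star (z (r, s)) =
      (\prod_(t < n.+1 | (t < s)%N) z (t, t)) *
      (\prod_(s <= t < r) z (inord t, inord t.+1)) *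
      (\prod_(t < n.+1 | (r < t)%N) z (t, t));
  crystal_star_upper : forall r s : 'I_n.+1, (r < s)%N ->
    star (z (r, s)) =
      (\prod_(t < n.+1 | (t < r)%N) z (t, t)) *
      (\prod_(r <= t < s) z (inord t.+1, inord t)) *
      (\prod_(t < n.+1 | (s < t)%N) z (t, t));
  crystal_star_diag : forall s : 'I_n.+1,
    star (z (s, s)) =
      (\prod_(t < n.+1 | (t < s)%N) z (t, t)) *
      (\prod_(t < n.+1 | (s < t)%N) z (t, t));
  crystal_star_comm : forall i j r s : 'I_n.+1, i != r -> j != s ->
    star (z (i, j)) * z (r, s) = z (r, s) * star (z (i, j))
}.

End Universal.

(* Main.v *)
From HB Require Import structures.
From mathcomp Require Import all_boot all_order all_algebra.
From mathcomp Require Import complex.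
From mathcomp Require Import all_classical all_reals all_analysis.
From mathcomp Require Import ring lra zify.
Require Import Defs.

(** The existence of a universal C*-algebra splits into a general construction
    and an estimate that is specific to the crystal relations.

    Let a system of relations be given together with a bound [M i] on the norm
    of each generator that holds in every C*-algebra. Terms built from the
    generators by the operations of a *-algebra are evaluated in every
    C*-algebra that carries a family satisfying the relations; identifying
    terms with equal evaluations gives a *-algebra, normed by the supremum of
    the norms of the evaluations, which is finite because of [M]. The
    C*-identity passes to the supremum. Admitting formal limits of uniformly convergent sequences among
    the terms makes this algebra complete, and the evaluations are the required
    homomorphisms. Uniqueness of these homomorphisms needs that unital
    *-homomorphisms are continuous ([hom_contractive]). Spectral theory is
    avoided by a classical trick: a self-adjoint [h] with [|h| < 1] is the real
    part of the unitary [h + i sqrt (1 - h^2)], unitaries are mapped to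
    unitaries, and these have norm at most one. The outcome is
    [universal_cstar_algebra_exists].

    For the crystal relations each generator has norm at most one
    ([crystal_le1]). By transposition only entries [z s k] with [k <= s] matter.
    Write [star (z s k)] as the product prescribed by the relations. Commuting
    entries past the diagonal ones makes [sum_(k <= s) z s k * star (z s k)]
    telescope to the product of all diagonal entries, that is to [1]
    ([sum_row]), and a second commutation argument gives
    [star (z s k) * z s l = 0] for [k < l <= s] ([star_row_mul0]). Thus the
    elements [z s k * star (z s k)] are orthogonal projections with sum [1], so
    [z s k] is a partial isometry. *)

Set Implicit Arguments.
Unset Strict Implicit.
Unset Printing Implicit Defensive.

Import Order.TTheory GRing.Theory Num.Theory.
Import numFieldNormedType.Exports.

Local Open Scope classical_set_scope.
Local Open Scope ring_scope.
Local Open Scope complex_scope.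

(** * Real-valued norms and geometric convergence *)

Section RealNorm.
Context {R : realType}.

Lemma complex_gt0 (e : R[i]) : 0 < e -> exists2 r : R, 0 < r & e = r%:C.
Proof.
case: e => a b; rewrite ltcE /= => /andP[/eqP b0 a0].
by exists a; rewrite // b0.
Qed.

Section Normed.
Context {V : normedModType R[i]}.
Implicit Types x y : V.

(** The norm of a module over [R[i]] takes values in [R[i]]; suprema and
    numerical estimates need it as a real number. *)
Definition cnorm x : R := complex.Re `|x|.

Lemma cnormE x : `|x| = (cnorm x)%:C.
Proof. by rewrite /cnorm RRe_real // ger0_real. Qed.

Lemma cnorm_ge0 x : 0 <= cnorm x.
Proof. by rewrite -ler0c -cnormE. Qed.

Lemma cnorm0 : cnorm (0 : V) = 0.
Proof. by rewrite /cnorm normr0. Qed.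

Lemma cnorm_eq0 x : cnorm x = 0 -> x = 0.
Proof. by move=> h; apply/normr0_eq0; rewrite cnormE h. Qed.

Lemma cnormD x y : cnorm (x + y) <= cnorm x + cnorm y.
Proof. by rewrite -lecR rmorphD /= -!cnormE ler_normD. Qed.

Lemma cdistC x y : cnorm (x - y) = cnorm (y - x).
Proof. by rewrite /cnorm distrC. Qed.

Lemma cdist_triangle z x y : cnorm (x - y) <= cnorm (x - z) + cnorm (z - y).
Proof. by apply: le_trans (cnormD _ _); rewrite addrA subrK. Qed.

Lemma cnormZ (a : R[i]) x : cnorm (a *: x) = complex.Re `|a| * cnorm x.
Proof.
by apply: complexI; rewrite rmorphM /= -!cnormE normrZ.
Qed.

Lemma ball_cnorm x (r : R) y : ball x r%:C y <-> cnorm (x - y) < r.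
Proof. by rewrite -ball_normE /ball_ /= cnormE ltcR. Qed.

Lemma nbhs_cnorm x (P : set V) :
  nbhs x P <-> exists2 r : R, 0 < r & forall y, cnorm (x - y) < r -> P y.
Proof.
split=> [/nbhs_ballP[e /= /complex_gt0[r r0 ->] sP]|[r r0 sP]].
  by exists r => // y xy; apply/sP/ball_cnorm.
apply/nbhs_ballP; exists r%:C => /=; first by rewrite (_ : 0 = 0%:C) // ltcR.
by move=> y /ball_cnorm; exact: sP.
Qed.

(** Sequential form of closedness, the only one in which topology enters the
    algebraic arguments below. *)
Lemma closed_cnorm (S : set V) :
  closed S <->
  forall x, (forall e : R, 0 < e -> exists2 y, S y & cnorm (x - y) < e) -> S x.
Proof.
split=> [cS x xS|cS x xS].
  apply: cS => P /nbhs_cnorm[r r0 rP].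
  by have [y Sy xy] := xS r r0; exists y; split=> //; exact: rP.
apply: cS => e e0; have [|y [Sy xy]] := xS [set y | cnorm (x - y) < e].
  by apply/nbhs_cnorm; exists e.
by exists y.
Qed.

End Normed.

Lemma geometric_small (c q e : R) : 0 <= q -> q < 1 -> 0 < e ->
  exists k, c * q ^+ k < e.
Proof.
move=> q0 q1 e0.
have : (fun k => c * q ^+ k) @ \oo --> (0 : R).
  by apply: cvg_geometric; rewrite ger0_norm.
move/cvgrPdist_lt => /(_ e e0) [k _ kP]; exists k.
have := kP k (leqnn k); rewrite sub0r normrN; exact/le_lt_trans/ler_norm.
Qed.

Lemma geometric_tail {V : normedModType R[i]} (c q : R) (x : nat -> V) :
  0 <= q -> q < 1 ->
  (forall k, cnorm (x k.+1 - x k) <= c * q ^+ k) ->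
  forall k n, (k <= n)%N -> cnorm (x n - x k) <= c / (1 - q) * q ^+ k.
Proof.
move=> q0 q1 xq k n /subnKC <-.
have c0 : 0 <= c.
  by have := le_trans (cnorm_ge0 _) (xq 0%N); rewrite expr0 mulr1.
have q1' : 0 < 1 - q by rewrite subr_gt0.
move: (n - k)%N => m; elim: m k => [|m IH] k.
  by rewrite addn0 subrr cnorm0 !mulr_ge0 ?invr_ge0 ?exprn_ge0 // ltW.
rewrite addnS -addSn.
apply: le_trans (cdist_triangle (x k.+1) _ _) _.
apply: le_trans (lerD (IH _) (xq k)) _.
rewrite exprS -subr_ge0 le_eqVlt; apply/orP; left; apply/eqP.
by field; rewrite gt_eqF.
Qed.

(** Every limit below is the limit of a sequence with geometrically decreasing
    steps, so that each limit comes with an explicit rate. The rate, rather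
    than the filter convergence, is what the later arguments use. *)
Lemma geometric_cvg (V : completeNormedModType R[i]) (c q : R) (x : nat -> V) :
  0 <= q -> q < 1 ->
  (forall k, cnorm (x k.+1 - x k) <= c * q ^+ k) ->
  exists l, forall k, cnorm (l - x k) <= c / (1 - q) * q ^+ k.
Proof.
move=> q0 q1 xq; have tail := geometric_tail q0 q1 xq.
have : cauchy (x @ \oo).
  apply: cauchy_exP => _ /complex_gt0[e e0 ->].
  have [k kP] := geometric_small (c / (1 - q)) q0 q1 e0.
  exists (x k); exists k => // n /= kn; apply/ball_cnorm.
  by rewrite cdistC; exact: le_lt_trans (tail _ _ kn) kP.
move/cauchy_cvg => /cvg_ex[l xl]; exists l => k.
apply/ler_addgt0Pr => e e0.
have [|N _ NP] := xl [set y | cnorm (l - y) < e].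
  by apply/nbhs_cnorm; exists e.
have := NP (maxn N k) (leq_maxl _ _); rewrite /= => lt_e.
apply: le_trans (cdist_triangle (x (maxn N k)) _ _) _.
by rewrite addrC lerD ?tail ?leq_maxr // ltW.
Qed.

(** Conversely, sequences with geometric steps suffice for completeness: in a
    Cauchy filter, pick for each [k] a center [x k] of a ball of radius
    [2^-(k+1)] belonging to the filter. *)
Lemma geometric_complete (V : normedModType R[i]) :
  (forall x : nat -> V, (forall k, cnorm (x k.+1 - x k) <= 2^-1 ^+ k) ->
    exists l, forall e : R, 0 < e -> exists N, forall k, (N <= k)%N ->
       cnorm (l - x k) < e) ->
  forall F : set_system V, ProperFilter F -> cauchy F -> cvg F.
Proof.
move=> complV F FF /cauchyP cF.
have h0 : 0 < 2^-1 :> R by lra.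
have h1 : 2^-1 < 1 :> R by lra.
have e0 k : 0 < (2^-1 ^+ k.+1 : R) by rewrite exprn_gt0.
have /choice[x xP] : forall k, exists x, F (ball x (2^-1 ^+ k.+1)%:C).
  by move=> k; apply: cF; rewrite (_ : 0 = 0%:C) // ltcR.
have [k|l lP] := complV x.
  have [y [/ball_cnorm y1 /ball_cnorm y2]] :=
    filter_ex (filterI (xP k) (xP k.+1)).
  apply: le_trans (cdist_triangle y _ _) _.
  rewrite [X in _ + X]cdistC; apply: le_trans (lerD (ltW y2) (ltW y1)) _.
  have := e0 k; rewrite !exprS; have : 0 < (2^-1 ^+ k : R) by rewrite exprn_gt0.
  lra.
apply/cvg_ex; exists l => P /nbhs_cnorm[r r0 rP].
have r2 : 0 < r / 2 by lra.
have [N NP] := lP _ r2.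
have [m mP] := geometric_small 1 (ltW h0) h1 r2.
apply: filterS (xP (maxn N m)) => y /ball_cnorm xy; apply: rP.
apply: le_lt_trans (cdist_triangle (x (maxn N m)) _ _) _.
rewrite [ltRHS](_ : r = r / 2 + r / 2); last by lra.
apply: ltrD; first by rewrite NP // leq_maxl.
apply: lt_trans xy _; apply: le_lt_trans mP; rewrite mul1r.
by apply: ler_wiXn2l; rewrite ?ltW // ltnW // ltnS leq_maxr.
Qed.

End RealNorm.

(** * C*-algebras and their homomorphisms *)

Section CstarBasics.
Context {R : realType} {A : cstarAlgType R}.
Implicit Types x y h : A.

Lemma starD x y : star (x + y) = star x + star y.
Proof. exact: cstar_adjD. Qed.

Lemma starZ (a : R[i]) x : star (a *: x) = a^* *: star x.
Proof. exact: cstar_adjZ. Qed.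

Lemma starM x y : star (x * y) = star y * star x.
Proof. exact: cstar_adjM. Qed.

Lemma starK x : star (star x) = x.
Proof. exact: cstar_adjK. Qed.

Lemma star0 : star (0 : A) = 0.
Proof. by apply: (@addrI _ (star 0)); rewrite -starD !addr0. Qed.

Lemma starN x : star (- x) = - star x.
Proof. by apply: (@addrI _ (star x)); rewrite -starD !subrr star0. Qed.

Lemma starB x y : star (x - y) = star x - star y.
Proof. by rewrite starD starN. Qed.

Lemma star1 : star (1 : A) = 1.
Proof. by have := starM (star 1) (1 : A); rewrite mulr1 !starK mulr1. Qed.

Lemma calgZl (a : R[i]) x y : (a *: x) * y = a *: (x * y).
Proof. by symmetry; exact: cstar_scaleAl. Qed.

Lemma calgZr (a : R[i]) x y : x * (a *: y) = a *: (x * y).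
Proof. by symmetry; exact: cstar_scaleAr. Qed.

Lemma cnormM x y : cnorm (x * y) <= cnorm x * cnorm y.
Proof. by rewrite -lecR rmorphM /= -!cnormE; exact: cstar_normM. Qed.

Lemma cnorm_starM x : cnorm (star x * x) = cnorm x ^+ 2.
Proof. by apply: complexI; rewrite rmorphXn /= -!cnormE; exact: cstar_norm. Qed.

Lemma cnorm_star x : cnorm (star x) = cnorm x.
Proof.
wlog suff: x / cnorm x <= cnorm (star x).
  by move=> H; apply/le_anti; rewrite H -{2}[x]starK H.
have [->|x0] := eqVneq (cnorm x) 0; first exact: cnorm_ge0.
have {}x0 : 0 < cnorm x by rewrite lt_neqAle eq_sym x0 cnorm_ge0.
by rewrite -(ler_pM2r x0) -expr2 -cnorm_starM cnormM.
Qed.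

(** By the C*-identity a self-adjoint idempotent satisfies [|p|^2 = |p|]. *)
Lemma cnorm_projection_le1 (p : A) : star p = p -> p * p = p -> cnorm p <= 1.
Proof.
move=> ps pp; have := cnorm_starM p; rewrite ps pp.
by have := cnorm_ge0 p; nra.
Qed.

Lemma cnorm1_le1 : cnorm (1 : A) <= 1.
Proof. by apply: cnorm_projection_le1; [exact: star1|exact: mulr1]. Qed.

Lemma cnorm_isometry_le1 x : star x * x = 1 -> cnorm x <= 1.
Proof.
move=> xx; have := cnorm_starM x; rewrite xx.
by have := cnorm1_le1; have := cnorm_ge0 x; nra.
Qed.

Lemma cnorm_half x : cnorm (2^-1 *: x) = 2^-1 * cnorm x.
Proof.
rewrite cnormZ ger0_norm ?invr_ge0 //; congr (_ * _).
by rewrite (_ : 2^-1 = (2^-1)%:C) // fmorphV rmorph_nat.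
Qed.

Lemma half_double x : 2^-1 *: (x + x) = x.
Proof.
by rewrite scalerDr -scalerDl -[RHS]scale1r [in RHS](splitr 1) mul1r.
Qed.

(** Identities for a limit [l] of [w k] are obtained by bounding the norm of the
    defect by a multiple of [|l - w k|]. *)
Lemma geometric_eq0 (c q : R) x : 0 <= q -> q < 1 ->
  (forall k, cnorm x <= c * q ^+ k) -> x = 0.
Proof.
move=> q0 q1 xq; apply: cnorm_eq0; apply/le_anti; rewrite cnorm_ge0 andbT.
apply/ler_addgt0Pr => e e0; have [k /ltW] := geometric_small c q0 q1 e0.
by rewrite add0r; apply: le_trans.
Qed.

(** The root is [1 - w], where [w] is the fixed point of the contraction
    [w |-> (h^2 + w^2) / 2] of the ball of radius [|h|]; being a limit of
    polynomials in [h], it is self-adjoint and commutes with [h]. *)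
Lemma sqrt_one_sub_sqr h : star h = h -> cnorm h < 1 ->
  exists y, [/\ star y = y, y * h = h * y & y * y = 1 - h * h].
Proof.
move=> hs h1; set q := cnorm h in h1; have q0 : 0 <= q := cnorm_ge0 h.
(* (1 - w)^2 = 1 - h^2 holds exactly when w is fixed by f. *)
pose f (w : A) := 2^-1 *: (h * h + w * w); pose w k := iter k f 0.
have fB v v' : cnorm (f v - f v') <=
    2^-1 * ((cnorm v + cnorm v') * cnorm (v - v')).
  rewrite -scalerBr cnorm_half ler_pM2l ?invr_gt0 //.
  rewrite (_ : _ - _ = v * (v - v') + (v - v') * v'); last first.
    by rewrite mulrBr mulrBl opprD !addrA addrNK [h * h + _]addrC addrK.
  apply: le_trans (cnormD _ _) _; rewrite [leRHS]mulrDl lerD ?cnormM //.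
  by rewrite [leRHS]mulrC cnormM.
have wq k : cnorm (w k) <= q.
  elim: k => [|k IH]; first by rewrite cnorm0.
  rewrite /= cnorm_half; have := cnormD (h * h) (w k * w k).
  by have := cnormM h h; have := cnormM (w k) (w k);
    have := cnorm_ge0 (w k); rewrite -/q; nra.
have wS k : cnorm (w k.+1 - w k) <= 1 * q ^+ k.
  rewrite mul1r; elim: k => [|k IH].
    by rewrite subr0; apply: le_trans (wq 1%N) (ltW h1).
  apply: le_trans (fB _ _) _; rewrite exprS.
  by have := wq k; have := wq k.+1; have := cnorm_ge0 (w k.+1 - w k); nra.
have [l] := geometric_cvg q0 h1 wS; move: (1 / (1 - q)) => c lw.
have lw0 := cnorm_ge0 (l - w _).
have lf : l = f l.
  apply/eqP; rewrite -subr_eq0; apply/eqP.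
  apply: (geometric_eq0 (c := c + 2^-1 * ((q + cnorm l) * c)) q0 h1) => k.
  apply: le_trans (cdist_triangle (w k.+1) _ _) _; rewrite mulrDl; apply: lerD.
    apply: le_trans (lw _) _; rewrite exprS.
    by have := le_trans (lw0 k) (lw k); nra.
  apply: le_trans (fB _ _) _; rewrite -!mulrA ler_pM2l ?invr_gt0 //.
  apply: ler_pM; rewrite ?addr_ge0 ?cnorm_ge0 ?lerD2r ?wq //.
  by rewrite cdistC lw.
have ws k : star (w k) = w k.
  elim: k => [|k IH]; first exact: star0.
  by rewrite /= starZ starD !starM hs IH fmorphV rmorph_nat.
have wh k : w k * h = h * w k.
  elim: k => [|k IH]; first by rewrite mul0r mulr0.
  by rewrite /= calgZl calgZr mulrDl mulrDr -!mulrA IH !mulrA IH.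
have ls : star l = l.
  apply/eqP; rewrite -subr_eq0; apply/eqP.
  apply: (geometric_eq0 (c := c + c) q0 h1) => k; rewrite mulrDl.
  apply: le_trans (cdist_triangle (w k) _ _) (lerD _ _).
    by rewrite -[X in _ - X]ws -starB cnorm_star lw.
  by rewrite cdistC lw.
have lh : l * h = h * l.
  apply/eqP; rewrite -subr_eq0; apply/eqP.
  apply: (geometric_eq0 (c := c + c) q0 h1) => k; rewrite mulrDl.
  have lhw : q * cnorm (l - w k) <= c * q ^+ k.
    by apply: le_trans (lw k); have := lw0 k; nra.
  apply: le_trans (cdist_triangle (w k * h) _ _) (lerD _ _).
    by rewrite -mulrBl; apply: le_trans (cnormM _ _) _; rewrite mulrC.
  by rewrite wh -mulrBr; apply: le_trans (cnormM _ _) _; rewrite cdistC.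
exists (1 - l); split; first by rewrite starB star1 ls.
  by rewrite mulrBl mulrBr mul1r mulr1 lh.
have l2 : l + l = h * h + l * l.
  by rewrite [in LHS]lf -scalerDr half_double.
have -> : h * h = l + l - l * l by rewrite l2 addrK.
by rewrite mulrBl mul1r mulrBr mulr1 !opprB opprD !addrA [1 - l + _]addrAC.
Qed.

End CstarBasics.

Section Contractive.
Context {R : realType} {A B : cstarAlgType R}.
Variable phi : A -> B.
Hypothesis phi_hom : unital_star_hom phi.

Lemma homD x y : phi (x + y) = phi x + phi y.
Proof.
by case: phi_hom => lin _ _; have := lin 1 x y; rewrite !scale1r.
Qed.

Lemma hom0 : phi 0 = 0.
Proof. by apply: (@addrI _ (phi 0)); rewrite -homD !addr0. Qed.

Lemma homZ a x : phi (a *: x) = a *: phi x.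
Proof.
by case: phi_hom => lin _ _; have := lin a x 0; rewrite hom0 !addr0.
Qed.

Lemma homN x : phi (- x) = - phi x.
Proof. by rewrite -scaleN1r homZ scaleN1r. Qed.

Lemma homB x y : phi (x - y) = phi x - phi y.
Proof. by rewrite homD homN. Qed.

Lemma hom1 : phi 1 = 1.
Proof. by case: phi_hom => _ []. Qed.

Lemma homM x y : phi (x * y) = phi x * phi y.
Proof. by case: phi_hom => _ []. Qed.

Lemma hom_star x : phi (star x) = star (phi x).
Proof. by case: phi_hom. Qed.

(** A self-adjoint [h] of norm less than one is the real part of the unitary
    [h + i sqrt (1 - h^2)], and homomorphisms preserve unitaries. *)
Lemma hom_selfadjoint_le1 h : star h = h -> cnorm h < 1 -> cnorm (phi h) <= 1.
Proof.
move=> hs h1; have [y [ys yh yy]] := sqrt_one_sub_sqr hs h1.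
pose u := h + 'i%R *: y.
have us : star u = h - 'i%R *: y.
  by rewrite starD starZ hs ys conjCi scaleNr.
have uu : star u * u = 1.
  rewrite us mulrBl !mulrDr !calgZl !calgZr yh scalerA.
  rewrite -[_ * 'i%R]expr2 sqrCi scaleN1r yy.
  by rewrite opprD opprK -addrA addNKr addrC subrK.
have hu : phi h + phi h = phi u + star (phi u).
  by rewrite -hom_star -!homD us /u addrACA subrr addr0.
have pu : cnorm (phi u) <= 1.
  by apply: cnorm_isometry_le1; rewrite -hom_star -homM uu hom1.
rewrite -[phi h]half_double hu cnorm_half.
by have := cnormD (phi u) (star (phi u)); rewrite cnorm_star; lra.
Qed.

(** Homomorphisms are automatically continuous. For self-adjoint elements this
    is the previous lemma after rescaling; the C*-identity reduces the general
    case to [star x * x]. *)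
Lemma hom_contractive x : cnorm (phi x) <= cnorm x.
Proof.
have sa h : star h = h -> cnorm (phi h) <= cnorm h.
  move=> hs; apply/ler_addgt0Pr => e e0.
  set s := cnorm h + e; have s0 : 0 < s by have := cnorm_ge0 h; rewrite /s; lra.
  have cs (C : cstarAlgType R) (z : C) :
      cnorm (s^-1%:C *: z) = s^-1 * cnorm z.
    by rewrite cnormZ ger0_norm // ler0c invr_ge0 ltW.
  have : cnorm (phi (s^-1%:C *: h)) <= 1.
    apply: hom_selfadjoint_le1.
      by rewrite starZ hs conj_Creal // complex_real.
    by rewrite cs // mulrC ltr_pdivrMr // mul1r /s; lra.
  by rewrite homZ cs // mulrC ler_pdivrMr // mul1r.
have xx : cnorm (phi x) ^+ 2 <= cnorm x ^+ 2.
  by rewrite -!cnorm_starM -hom_star -homM sa // starM starK.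
by rewrite -(@ler_pXn2r _ 2) // nnegrE cnorm_ge0.
Qed.

End Contractive.

(** * The universal C*-algebra of a bounded system of relations *)

Section UniversalAlgebra.
Context {R : realType} {I : Type}.
Variable rel : forall B : cstarAlgType R, (I -> B) -> Prop.
Variable M : I -> R.

(** The prescribed bounds [M] on the generators make the supremum defining the
    universal norm finite, whatever the relations are. *)
Definition admissible (B : cstarAlgType R) (b : I -> B) :=
  rel b /\ forall i, cnorm (b i) <= M i.

(** Names for the elements of the universal algebra: noncommutative
    *-polynomials in the generators, and limits of sequences of names. With
    [Lim] as a constructor the completion is part of the syntax, and all the
    algebraic operations are defined on names, with no limits involved. The
    names form a set even though the algebras they are evaluated in do not. *)
Inductive term : Type :=
| Var of I
| One
| Add of term & term
| Mul of term & term
| Scale of R[i] & term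
| Star of term
| Lim of nat -> term.

(** For a term that is [convergent] in the sense below and an admissible family,
    the limit exists ([eval_Lim]) and the default value [0] is not reached. *)
Fixpoint eval (B : cstarAlgType R) (b : I -> B) (t : term) : B :=
  match t with
  | Var i => b i
  | One => 1
  | Add s t => eval b s + eval b t
  | Mul s t => eval b s * eval b t
  | Scale a t => a *: eval b t
  | Star t => star (eval b t)
  | Lim f =>
      xget 0 [set l | forall k, cnorm (l - eval b (f k)) <= 2 * 2^-1 ^+ k]
  end.

(** The convergence of the sequences under [Lim] is uniform over all admissible
    families, so that a limit term still names an element of bounded norm, and
    this element is the limit of the sequence in the universal norm. *)
Inductive convergent : term -> Prop :=
| convergent_Var i : convergent (Var i)
| convergent_One : convergent One
| convergent_Add s t : convergent s -> convergent t -> convergent (Add s t)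
| convergent_Mul s t : convergent s -> convergent t -> convergent (Mul s t)
| convergent_Scale a t : convergent t -> convergent (Scale a t)
| convergent_Star t : convergent t -> convergent (Star t)
| convergent_Lim f : (forall k, convergent (f k)) ->
    (forall k (B : cstarAlgType R) (b : I -> B), admissible b ->
      cnorm (eval b (f k.+1) - eval b (f k)) <= 2^-1 ^+ k) ->
    convergent (Lim f).

Lemma eval_Lim f (B : cstarAlgType R) (b : I -> B) :
  (forall k, cnorm (eval b (f k.+1) - eval b (f k)) <= 2^-1 ^+ k) ->
  forall k, cnorm (eval b (Lim f) - eval b (f k)) <= 2 * 2^-1 ^+ k.
Proof.
move=> fS; have [||k|l lP] := @geometric_cvg R B 1 2^-1 (fun k => eval b (f k)).
- lra.
- lra.
- by rewrite mul1r.
apply: (@xgetPex _ _ [set l : B | forall k,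
  cnorm (l - eval b (f k)) <= 2 * 2^-1 ^+ k]).
exists l => k; apply: le_trans (lP k) _.
by rewrite (_ : 1 / (1 - 2^-1) = 2) //; field.
Qed.

Lemma eval_bounded t : convergent t ->
  exists c, forall (B : cstarAlgType R) (b : I -> B),
    admissible b -> cnorm (eval b t) <= c.
Proof.
elim=> {t} [i||s t _ [c cP] _ [d dP]|s t _ [c cP] _ [d dP]|a t _ [c cP]
            |t _ [c cP]|f _ fB fS].
- by exists (M i) => B b [_]; apply.
- by exists 1 => B b _; exact: cnorm1_le1.
- exists (c + d) => B b bP.
  exact: le_trans (cnormD _ _) (lerD (cP _ _ bP) (dP _ _ bP)).
- exists (c * d) => B b bP; apply: le_trans (cnormM _ _) _.
  by rewrite ler_pM ?cnorm_ge0 ?cP ?dP.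
- exists (complex.Re `|a| * c) => B b bP; rewrite /= cnormZ ler_wpM2l ?cP //.
  by rewrite -ler0c RRe_real ?ger0_real.
- by exists c => B b bP; rewrite /= cnorm_star cP.
have [c cP] := fB 0%N; exists (2 + c) => B b bP.
rewrite -[eval _ _](subrK (eval b (f 0%N))).
apply: le_trans (cnormD _ _) (lerD _ (cP _ _ bP)).
have := @eval_Lim f B b (fun k => fS k B b bP) 0%N.
by rewrite expr0 mulr1.
Qed.

HB.instance Definition _ := gen_eqMixin term.
HB.instance Definition _ := gen_choiceMixin term.

Definition cterm := {t : term | `[< convergent t >]}.
HB.instance Definition _ := Choice.on cterm.

Definition same_eval (s t : cterm) : bool :=
  `[< forall (B : cstarAlgType R) (b : I -> B),
        admissible b -> eval b (val s) = eval b (val t) >].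

Lemma same_eval_equiv : equiv_class_of same_eval.
Proof.
split=> [t|s t|s t u].
- by apply/asboolP.
- by apply/asboolP/asboolP => st B b bP; rewrite st.
- by move=> /asboolP st /asboolP tu; apply/asboolP => B b bP; rewrite st ?tu.
Qed.

Canonical same_eval_equivRel := EquivRelPack same_eval_equiv.

Definition univ_alg := {eq_quot same_eval}%qT.
HB.instance Definition _ := Choice.on univ_alg.

Definition univ_class t (ct : convergent t) : univ_alg :=
  (\pi_univ_alg (exist _ t (asboolT ct) : cterm))%qT.

Definition evalq (B : cstarAlgType R) (b : I -> B) (x : univ_alg) : B :=
  eval b (val (repr x)).

Lemma evalq_class t (ct : convergent t) (B : cstarAlgType R) (b : I -> B) :
  admissible b -> evalq b (univ_class ct) = eval b t.
Proof.
move=> bP; rewrite /evalq /univ_class; case: piP => s /eqmodP.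
by move=> /asboolP /(_ B b bP).
Qed.

(** Evaluations separate the points of the quotient; hence every identity that
    holds in all C*-algebras holds in it, the axioms of a *-algebra among them. *)
Lemma evalq_inj x y :
  (forall (B : cstarAlgType R) (b : I -> B),
     admissible b -> evalq b x = evalq b y) -> x = y.
Proof.
move=> xy; rewrite -[x]reprK -[y]reprK; apply/eqmodP/asboolP => B b bP.
exact: xy.
Qed.

Lemma convergent_repr (x : univ_alg) : convergent (val (repr x)).
Proof. exact/asboolP/(valP (repr x)). Qed.

Implicit Types x y : univ_alg.

Definition uone : univ_alg := univ_class convergent_One.
Definition uadd x y : univ_alg :=
  univ_class (convergent_Add (convergent_repr x) (convergent_repr y)).
Definition umul x y : univ_alg :=
  univ_class (convergent_Mul (convergent_repr x) (convergent_repr y)).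
Definition uscale a x : univ_alg :=
  univ_class (convergent_Scale a (convergent_repr x)).
Definition ustar x : univ_alg :=
  univ_class (convergent_Star (convergent_repr x)).
Definition uvar i : univ_alg := univ_class (convergent_Var i).
Definition uzero : univ_alg := uscale 0 uone.
Definition uopp x : univ_alg := uscale (-1) x.

Section Evaluation.
Variables (B : cstarAlgType R) (b : I -> B).
Hypothesis bP : admissible b.

Lemma evalq1 : evalq b uone = 1.
Proof. by rewrite evalq_class. Qed.

Lemma evalqD x y : evalq b (uadd x y) = evalq b x + evalq b y.
Proof. by rewrite evalq_class. Qed.

Lemma evalqM x y : evalq b (umul x y) = evalq b x * evalq b y.
Proof. by rewrite evalq_class. Qed.

Lemma evalqZ a x : evalq b (uscale a x) = a *: evalq b x.
Proof. by rewrite evalq_class. Qed.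

Lemma evalq_star x : evalq b (ustar x) = star (evalq b x).
Proof. by rewrite evalq_class. Qed.

Lemma evalq_var i : evalq b (uvar i) = b i.
Proof. by rewrite evalq_class. Qed.

Lemma evalq0 : evalq b uzero = 0.
Proof. by rewrite evalqZ scale0r. Qed.

Lemma evalqN x : evalq b (uopp x) = - evalq b x.
Proof. by rewrite evalqZ scaleN1r. Qed.

End Evaluation.

Fact uaddA : associative uadd.
Proof.
by move=> x y z; apply: evalq_inj => B b bP; rewrite !evalqD // addrA.
Qed.

Fact uaddC : commutative uadd.
Proof. by move=> x y; apply: evalq_inj => B b bP; rewrite !evalqD // addrC. Qed.

Fact uadd0 : left_id uzero uadd.
Proof.
by move=> x; apply: evalq_inj => B b bP; rewrite evalqD // evalq0 // add0r.
Qed.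

Fact uaddN : left_inverse uzero uopp uadd.
Proof.
move=> x; apply: evalq_inj => B b bP.
by rewrite evalqD // evalqN // evalq0 // addNr.
Qed.

HB.instance Definition _ :=
  GRing.isZmodule.Build univ_alg uaddA uaddC uadd0 uaddN.

Fact uscaleA a a' x : uscale a (uscale a' x) = uscale (a * a') x.
Proof. by apply: evalq_inj => B b bP; rewrite !evalqZ // scalerA. Qed.

Fact uscale1 : left_id 1 uscale.
Proof. by move=> x; apply: evalq_inj => B b bP; rewrite evalqZ // scale1r. Qed.

Fact uscaleDr : right_distributive uscale +%R.
Proof.
move=> a x y; apply: evalq_inj => B b bP.
by rewrite evalqZ // !evalqD // !evalqZ // scalerDr.
Qed.

Fact uscaleDl x : {morph uscale^~ x : a a' / a + a'}.
Proof.
move=> a a'; apply: evalq_inj => B b bP.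
by rewrite evalqD // !evalqZ // scalerDl.
Qed.

HB.instance Definition _ := GRing.Zmodule_isLmodule.Build R[i] univ_alg
  uscaleA uscale1 uscaleDr uscaleDl.

(** The universal norm is a supremum over all admissible families in all
    C*-algebras: a set of real numbers, although the families are too many to
    form a product of algebras. The value [0] keeps it nonempty when there is no
    admissible family, in which case the universal algebra is zero. *)
Definition unorm_set x : set R := [set r | r = 0 \/
  exists (B : cstarAlgType R) (b : I -> B),
    admissible b /\ r = cnorm (evalq b x)].

Definition unorm x : R := sup (unorm_set x).

Lemma unorm_has_sup x : has_sup (unorm_set x).
Proof.
split; first by exists 0; left.
have [c cP] := eval_bounded (convergent_repr x).
exists (Num.max 0 c) => _ [->|[B [b [bP ->]]]]; rewrite le_max ?lexx //.
by rewrite [cnorm _ <= c]cP // orbT.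
Qed.

Lemma unorm_ge0 x : 0 <= unorm x.
Proof. by apply: ub_le_sup; [case: (unorm_has_sup x)|left]. Qed.

Lemma evalq_le (B : cstarAlgType R) (b : I -> B) x :
  admissible b -> cnorm (evalq b x) <= unorm x.
Proof.
move=> bP; apply: ub_le_sup; first by case: (unorm_has_sup x).
by right; exists B, b.
Qed.

Lemma unorm_le x c : 0 <= c ->
  (forall (B : cstarAlgType R) (b : I -> B),
    admissible b -> cnorm (evalq b x) <= c) ->
  unorm x <= c.
Proof.
move=> c0 xc; apply: ge_sup; first by exists 0; left.
by move=> _ [->|[B [b [bP ->]]]] //; exact: xc.
Qed.

Fact unormD x y : (unorm (x + y))%:C <= (unorm x)%:C + (unorm y)%:C.
Proof.
rewrite -rmorphD lecR; apply: unorm_le; first by rewrite addr_ge0 ?unorm_ge0.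
move=> B b bP; rewrite evalqD //.
by apply: le_trans (cnormD _ _) _; rewrite lerD ?evalq_le.
Qed.

Fact unormZ_le (a : R[i]) x : unorm (a *: x) <= complex.Re `|a| * unorm x.
Proof.
have a0 : 0 <= complex.Re `|a| by rewrite -ler0c RRe_real ?ger0_real.
apply: unorm_le => [|B b bP]; first by rewrite mulr_ge0 ?unorm_ge0.
by rewrite evalqZ // cnormZ ler_wpM2l ?evalq_le.
Qed.

Fact unormZ (a : R[i]) x : (unorm (a *: x))%:C = `|a| * (unorm x)%:C.
Proof.
have aE : `|a| = (complex.Re `|a|)%:C by rewrite RRe_real ?ger0_real.
rewrite aE -rmorphM; congr (_%:C); apply/le_anti; rewrite unormZ_le andTb.
have [->|a0] := eqVneq a 0; first by rewrite normr0 mul0r unorm_ge0.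
have n0 : 0 < complex.Re `|a| by rewrite -ltcR -aE normr_gt0.
rewrite -ler_pdivlMl // -{1}[x]scale1r -(mulVf a0) -scalerA.
apply: le_trans (unormZ_le _ _) _; rewrite normfV ler_wpM2r ?unorm_ge0 //.
by rewrite [X in X^-1]aE -fmorphV.
Qed.

Fact unorm_eq0 x : (unorm x)%:C = 0 -> x = 0.
Proof.
move=> [x0]; apply: evalq_inj => B b bP; rewrite evalq0 //.
by apply/cnorm_eq0/le_anti; rewrite cnorm_ge0 andbT -x0 evalq_le.
Qed.

HB.instance Definition _ :=
  Lmodule_isNormed.Build R[i] univ_alg unormD unormZ unorm_eq0.

Lemma evalqB (B : cstarAlgType R) (b : I -> B) x y : admissible b ->
  evalq b (x - y) = evalq b x - evalq b y.
Proof. by move=> bP; rewrite evalqD // evalqN. Qed.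

Lemma unorm_class_Lim f (cf : forall k, convergent (f k))
    (cLf : convergent (Lim f)) k :
  cnorm (univ_class cLf - univ_class (cf k)) <= 2 * 2^-1 ^+ k.
Proof.
apply: unorm_le => [|B b bP]; first by rewrite mulr_ge0 ?exprn_ge0.
rewrite evalqB // !evalq_class //; apply: eval_Lim => {}k.
by inversion cLf; apply: H1.
Qed.

Fact univ_alg_complete (F : set_system univ_alg) :
  ProperFilter F -> cauchy F -> cvg F.
Proof.
apply: geometric_complete => x xS.
pose f k := val (repr (x k)).
have cf k : convergent (f k) := convergent_repr (x k).
have cLf : convergent (Lim f).
  apply: convergent_Lim => // k B b bP; apply: le_trans (xS k).
  by rewrite -[_ - _](evalqB (x k.+1) (x k) bP); exact: evalq_le.
exists (univ_class cLf) => e e0.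
have [||N NP] := @geometric_small R 2 2^-1 e _ _ e0; [lra|lra|].
exists N => k Nk; apply: le_lt_trans NP.
have -> : x k = univ_class (cf k).
  by apply: evalq_inj => B b bP; rewrite evalq_class.
apply: le_trans (unorm_class_Lim _ _ _) _.
by rewrite ler_pM2l // ler_wiXn2l //; lra.
Qed.

HB.instance Definition _ := Uniform_isComplete.Build univ_alg univ_alg_complete.

Definition univ_mod : completeNormedModType R[i] := univ_alg.

Fact umulA : associative umul.
Proof.
by move=> x y z; apply: evalq_inj => B b bP; rewrite !evalqM // mulrA.
Qed.

Fact umul1x : left_id uone umul.
Proof.
by move=> x; apply: evalq_inj => B b bP; rewrite evalqM // evalq1 // mul1r.
Qed.

Fact umulx1 : right_id uone umul.
Proof.
by move=> x; apply: evalq_inj => B b bP; rewrite evalqM // evalq1 // mulr1.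
Qed.

Fact umulDl : left_distributive umul +%R.
Proof.
move=> x y z; apply: evalq_inj => B b bP.
by rewrite evalqM // !evalqD // !evalqM // mulrDl.
Qed.

Fact umulDr : right_distributive umul +%R.
Proof.
move=> x y z; apply: evalq_inj => B b bP.
by rewrite evalqM // !evalqD // !evalqM // mulrDr.
Qed.

Fact umulZl (a : R[i]) x y : a *: umul x y = umul (a *: x) y.
Proof.
apply: evalq_inj => B b bP.
by rewrite evalqZ // !evalqM // evalqZ // calgZl.
Qed.

Fact umulZr (a : R[i]) x y : a *: umul x y = umul x (a *: y).
Proof.
apply: evalq_inj => B b bP.
by rewrite evalqZ // !evalqM // evalqZ // calgZr.
Qed.

Fact unormM x y : `|umul x y| <= `|x| * `|y|.
Proof.
rewrite !cnormE -rmorphM lecR; apply: unorm_le.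
  by rewrite mulr_ge0 ?cnorm_ge0.
move=> B b bP; rewrite evalqM //; apply: le_trans (cnormM _ _) _.
by rewrite ler_pM ?cnorm_ge0 ?evalq_le.
Qed.

Fact ustarD : {morph ustar : x y / x + y}.
Proof.
move=> x y; apply: evalq_inj => B b bP.
by rewrite evalqD // !evalq_star // evalqD // starD.
Qed.

Fact ustarZ (a : R[i]) x : ustar (a *: x) = a^* *: ustar x.
Proof.
apply: evalq_inj => B b bP.
by rewrite evalqZ // !evalq_star // evalqZ // starZ.
Qed.

Fact ustarM x y : ustar (umul x y) = umul (ustar y) (ustar x).
Proof.
apply: evalq_inj => B b bP.
by rewrite evalqM // !evalq_star // evalqM // starM.
Qed.

Fact ustarK : involutive ustar.
Proof.
by move=> x; apply: evalq_inj => B b bP; rewrite !evalq_star // starK.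
Qed.

Fact unorm_starM x : `|umul (ustar x) x| = `|x| ^+ 2.
Proof.
rewrite !cnormE -rmorphXn; congr (_%:C); apply/le_anti/andP; split.
  apply: unorm_le => [|B b bP]; first by rewrite exprn_ge0 ?cnorm_ge0.
  rewrite evalqM // evalq_star // cnorm_starM.
  by rewrite ler_pXn2r ?nnegrE ?cnorm_ge0 ?evalq_le.
rewrite -[leRHS]sqr_sqrtr ?cnorm_ge0 //.
rewrite ler_pXn2r ?nnegrE ?cnorm_ge0 ?sqrtr_ge0 //.
apply: unorm_le => [|B b bP]; first exact: sqrtr_ge0.
rewrite -(ger0_norm (cnorm_ge0 _)) -sqrtr_sqr ler_wsqrtr //.
by rewrite -cnorm_starM -evalq_star // -evalqM // evalq_le.
Qed.

Definition univ_cstar : cstarAlgType R :=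
  @CStarAlgebra R univ_mod uone umul ustar umulA umul1x umulx1 umulDl umulDr
    umulZl umulZr unormM ustarD ustarZ ustarM ustarK unorm_starM.

Definition univ_gen (i : I) : univ_cstar := uvar i.

Lemma evalq_hom (B : cstarAlgType R) (b : I -> B) : admissible b ->
  unital_star_hom (evalq b : univ_cstar -> B).
Proof.
move=> bP; split; last by move=> x; exact: evalq_star.
  by move=> a x y; rewrite /= -evalqZ // -evalqD.
by split; [exact: evalq1|move=> x y; exact: evalqM].
Qed.

(** Induction on names: a closed *-subalgebra containing the generators is
    stable under every constructor, [Lim] included. *)
Lemma univ_generates : generates univ_gen.
Proof.
move=> S Salg Sgen; apply/seteqP; split=> // x _.
suff main t : convergent t -> forall y : univ_cstar,
    (forall (B : cstarAlgType R) (b : I -> B),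
       admissible b -> evalq b y = eval b t) -> S y.
  exact: (main _ (convergent_repr x)).
elim=> {t x} [i||s t cs Ss ct St|s t cs Ss ct St|a t ct St|t ct St
             |f cf Sf fS] y yE.
- rewrite (_ : y = univ_gen i); first exact: Sgen.
  by apply: evalq_inj => B b bP; rewrite yE // evalq_var.
- rewrite (_ : y = 1); first exact: subcstar_1.
  by apply: evalq_inj => B b bP; rewrite yE // evalq1.
- rewrite (_ : y = (univ_class cs : univ_cstar) + univ_class ct).
    by apply: subcstar_D => //; [apply: Ss|apply: St] => B b bP;
      apply: evalq_class.
  by apply: evalq_inj => B b bP; rewrite yE // evalqD // !evalq_class.
- rewrite (_ : y = (univ_class cs : univ_cstar) * univ_class ct).
    by apply: subcstar_M => //; [apply: Ss|apply: St] => B b bP;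
      apply: evalq_class.
  by apply: evalq_inj => B b bP; rewrite yE // evalqM // !evalq_class.
- rewrite (_ : y = a *: (univ_class ct : univ_cstar)).
    by apply: subcstar_Z => //; apply: St => B b bP; apply: evalq_class.
  by apply: evalq_inj => B b bP; rewrite yE // evalqZ // !evalq_class.
- rewrite (_ : y = star (univ_class ct : univ_cstar)).
    by apply: subcstar_star => //; apply: St => B b bP; apply: evalq_class.
  by apply: evalq_inj => B b bP; rewrite yE // evalq_star // !evalq_class.
apply: ((closed_cnorm S).1 (subcstar_closed Salg)) => e e0.
have [||N NP] := @geometric_small R 2 2^-1 e _ _ e0; [lra|lra|].
exists (univ_class (cf N)).
  by apply: (Sf N) => B b bP; apply: evalq_class.
apply: le_lt_trans NP; pose cLf := convergent_Lim cf fS.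
rewrite (_ : y = univ_class cLf); first exact: unorm_class_Lim.
by apply: evalq_inj => B b bP; rewrite yE // evalq_class.
Qed.

End UniversalAlgebra.

(** The equalizer of two homomorphisms is a *-subalgebra, and it is closed
    because homomorphisms are contractive. *)
Lemma hom_eq_on_generators (R : realType) (I : Type) (A B : cstarAlgType R)
    (z : I -> A) (phi psi : A -> B) :
  generates z -> unital_star_hom phi -> unital_star_hom psi ->
  (forall i, phi (z i) = psi (z i)) -> phi = psi.
Proof.
move=> zgen phiP psiP zE; apply/funext => x.
have : [set x | phi x = psi x] = setT; last by move/seteqP => [_ /(_ x)]; apply.
apply: zgen => //; split=> /=.
- apply/closed_cnorm => y yS; apply/eqP; rewrite -subr_eq0; apply/eqP.
  apply/cnorm_eq0/le_anti; rewrite cnorm_ge0 andbT; apply/ler_addgt0Pr => e e0.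
  have [|w /= wE /ltW yw] := yS (e / 2); first lra.
  rewrite add0r (_ : e = e / 2 + e / 2); last lra.
  apply: le_trans (cdist_triangle (phi w) _ _) (lerD _ _).
    by rewrite -homB //; apply: le_trans (hom_contractive phiP _) _.
  rewrite wE -homB //; apply: le_trans (hom_contractive psiP _) _.
  by rewrite cdistC.
- by rewrite !hom1.
- by move=> u v uE vE; rewrite !homD // uE vE.
- by move=> a u uE; rewrite !homZ // uE.
- by move=> u v uE vE; rewrite !homM // uE vE.
- by move=> u uE; rewrite !hom_star // uE.
Qed.

(** Besides the norm bounds, the relations must pass to the universal algebra.
    Its evaluations separate points, so it is enough that the relations be
    inherited from a separating family of homomorphisms, as are all systems of
    equations between *-polynomials. *)
Theorem universal_cstar_algebra_exists (R : realType) (I : Type)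
    (rel : forall B : cstarAlgType R, (I -> B) -> Prop) (M : I -> R) :
  (forall (B : cstarAlgType R) (b : I -> B), rel B b ->
     forall i, cnorm (b i) <= M i) ->
  (forall (A : cstarAlgType R) (z : I -> A),
     (forall x y : A,
        (forall (B : cstarAlgType R) (phi : A -> B), unital_star_hom phi ->
           rel B (phi \o z) -> phi x = phi y) -> x = y) ->
     rel A z) ->
  exists (A : cstarAlgType R) (z : I -> A), universal_cstar_algebra rel z.
Proof.
move=> rel_bounded rel_closed.
have adm (B : cstarAlgType R) (b : I -> B) : rel B b -> admissible rel M b.
  by move=> bP; split=> //; exact: rel_bounded.
have gen_eval (B : cstarAlgType R) (b : I -> B) :
  rel B b -> forall i, evalq b (univ_gen rel M i) = b i.
  by move=> bP i; apply: evalq_var; exact: adm.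
exists (univ_cstar rel M), (univ_gen rel M); split.
- apply: rel_closed => x y xy; apply: evalq_inj => B b bP.
  apply: (xy B (evalq b)); first exact: evalq_hom.
  suff -> : evalq b \o univ_gen rel M = b by case: bP.
  by apply/funext => i; apply: gen_eval; case: bP.
- exact: univ_generates.
move=> B b bP; exists (evalq b).
split; first by split; [exact/evalq_hom/adm|exact: gen_eval].
move=> psi [psiP psiE].
apply: (hom_eq_on_generators (@univ_generates _ _ rel M)) => //.
  exact/evalq_hom/adm.
by move=> i; rewrite psiE gen_eval.
Qed.

(** * Norm bounds for the crystal relations *)

(** The entries of a fixed row [s] up to the diagonal. Indices are natural
    numbers, which spares the bookkeeping of successors in an ordinal type. In
    terms of the products below, [star (Z s k)] is [D k * U k * T]. *)
Section CrystalRows.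
Context {R : realType} {B : cstarAlgType R} {N : nat}.
Variable Z : nat -> nat -> B.
Hypothesis Zcol : forall i j k, (i < k < N)%N -> (j < N)%N ->
  Z i j * Z k j = 0.
Hypothesis Zanti : forall i j k l, (i < k < N)%N -> (j < l < N)%N ->
  Z i l * Z k j = Z k j * Z i l.
Hypothesis Zmain : forall i j k l, (i < k < N)%N -> (j < l < N)%N ->
  ((maxn i j).+1 < minn k l)%N -> Z i j * Z k l = Z k l * Z i j.
Hypothesis Zbracket : forall i j k l, (i < k < N)%N -> (j < l < N)%N ->
  (maxn i j).+1 = minn k l -> Z i j * Z k l = Z k l * Z i j + Z i l * Z k j.
Hypothesis Zdet : \prod_(0 <= t < N) Z t t = 1.
Hypothesis Zstar : forall s k, (k <= s < N)%N -> star (Z s k) =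
  (\prod_(0 <= t < k) Z t t) * (\prod_(k <= t < s) Z t t.+1) *
  (\prod_(s.+1 <= t < N) Z t t).

Variable s : nat.
Hypothesis sN : (s < N)%N.

Let D k := \prod_(0 <= t < k) Z t t.
Let U k := \prod_(k <= t < s) Z t t.+1.
Let T := \prod_(s.+1 <= t < N) Z t t.
Let p k := Z s k * star (Z s k).

Lemma prod_nat_comm m n (F : nat -> B) x :
  (forall i, (m <= i < n)%N -> F i * x = x * F i) ->
  (\prod_(m <= i < n) F i) * x = x * \prod_(m <= i < n) F i.
Proof.
move=> Fx; symmetry; rewrite big_nat.
by apply: commr_prod => i /Fx; symmetry.
Qed.

(** Moving [Z s k.+1] to the left through the diagonal product [D k.+1] meets
    a nonzero commutator only at the last factor [Z k k], and that commutator
    [Z s k * Z k k.+1] turns the product into the same expression for [k]. *)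
Lemma telescope k : (k < s)%N ->
  D k.+1 * Z s k.+1 * U k.+1 * T = p k.+1 + D k * Z s k * U k * T.
Proof.
move=> ks; rewrite /p Zstar ?sN ?andbT // -/(D k.+1) -/(U k.+1) -/T.
have -> : D k.+1 = D k * Z k k by rewrite /D big_nat_recr.
have -> : U k = Z k k.+1 * U k.+1 by rewrite /U big_ltn.
have DZ : D k * Z s k.+1 = Z s k.+1 * D k.
  apply: prod_nat_comm => i /andP[_ ik]; apply: Zmain; rewrite ?maxnn; lia.
have ZZ : Z k k * Z s k.+1 = Z s k.+1 * Z k k + Z s k * Z k k.+1.
  rewrite Zbracket ?(@Zanti k k s k.+1) ?maxnn //; lia.
by rewrite -(mulrA (D k)) ZZ mulrDr !mulrDl !mulrA DZ.
Qed.

(** One half of the unitarity of the matrix [Z]: at [k = s] the telescoped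
    expression is the product of all diagonal entries, which is [1]. *)
Lemma sum_row : \sum_(j < s.+1) p j = 1.
Proof.
have sumE k : (k <= s)%N -> \sum_(j < k.+1) p j = D k * Z s k * U k * T.
  elim: k => [|k IH] ks.
    have D0 : D 0%N = 1 by rewrite /D big_geq.
    by rewrite big_ord1 /p Zstar // -/(D 0%N) D0 !mul1r !mulrA.
  by rewrite big_ord_recr /= IH ?(ltnW ks) // addrC telescope.
rewrite sumE // -[in RHS]Zdet /U [\prod_(s <= t < s) _]big_geq // mulr1.
rewrite (big_cat_nat (leq0n s) (ltnW sN)) /=.
by rewrite [\prod_(s <= t < N) _]big_ltn // mulrA.
Qed.

(** The factors of [U k] from column [l.+1] on commute with [Z t l]; the
    factor just before them lies in column [l], above [Z t l]. *)
Lemma superdiag_mul0 k l t : (k < l <= s)%N -> (s <= t < N)%N ->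
  U k * Z t l = 0.
Proof.
move=> /andP[kl ls] /andP[st tN].
rewrite /U (big_cat_nat (ltnW kl) ls) /= -mulrA.
rewrite [X in _ * X]prod_nat_comm; last first.
  by move=> i /andP[li ls']; apply: Zanti; lia.
case: l kl ls => // l kl ls.
rewrite big_nat_recr //= !mulrA -(mulrA _ _ (Z t _)) Zcol ?mulr0 ?mul0r //; lia.
Qed.

(** Moving [Z s l] to the left through [T] produces, besides [Z s l] itself,
    a term starting with [Z s.+1 l]; the superdiagonal product [U k] kills
    both. *)
Lemma star_row_mul0 k l : (k < l <= s)%N -> star (Z s k) * Z s l = 0.
Proof.
move=> kls; have /andP[kl ls] := kls.
rewrite Zstar ?sN ?andbT; last lia.
rewrite -/(D k) -/(U k) -/T -!mulrA.
suff -> : U k * (T * Z s l) = 0 by rewrite mulr0.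
have [Ns|sN'] := leqP N s.+1.
  by rewrite /T big_geq // mul1r superdiag_mul0 // leqnn.
have -> : T = Z s.+1 s.+1 * \prod_(s.+2 <= t < N) Z t t by rewrite /T big_ltn.
rewrite -mulrA prod_nat_comm; last first.
  by move=> i /andP[si iN]; symmetry; apply: Zmain; lia.
have -> : Z s.+1 s.+1 * (Z s l * \prod_(s.+2 <= t < N) Z t t) =
  (Z s l * Z s.+1 s.+1 - Z s.+1 l * Z s s.+1) * \prod_(s.+2 <= t < N) Z t t.
  rewrite mulrA; congr (_ * _); apply/eqP; rewrite eq_sym subr_eq.
  apply/eqP; rewrite -(@Zanti s l s.+1 s.+1); [|lia|lia].
  by rewrite (@Zbracket s l s.+1 s.+1) //; lia.
rewrite !mulrA mulrBr !mulrA superdiag_mul0 ?superdiag_mul0 //; try lia.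
by rewrite !mul0r subrr mul0r.
Qed.

(** The self-adjoint elements [p j] have sum [1] and are pairwise orthogonal,
    hence they are idempotent. This replaces the order structure of the algebra,
    which would bound each term of a sum of positive elements directly. *)
Lemma row_le1 k : (k <= s)%N -> cnorm (Z s k) <= 1.
Proof.
move=> ks.
have ps j : star (p j) = p j by rewrite /p starM starK.
have pp0 i j : (i < j <= s)%N -> p i * p j = 0.
  by move=> ij; rewrite /p mulrA -(mulrA (Z s i)) star_row_mul0 // mulr0 mul0r.
have pp : p k * p k = p k.
  have kS : (k < s.+1)%N by [].
  rewrite -[RHS]mulr1 -sum_row mulr_sumr (bigD1 (Ordinal kS)) //=.
  rewrite big1 ?addr0 // => j; rewrite -val_eqE /= => jk.
  have := ltn_ord j; rewrite ltnS => js.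
  case: (ltngtP j k) jk => // jk _; last by rewrite pp0 // jk js.
  by rewrite -[LHS]starK starM !ps pp0 ?star0 // jk ks.
have p1 : cnorm (p k) <= 1.
  exact: cnorm_projection_le1.
have : cnorm (Z s k) ^+ 2 <= 1.
  by rewrite -cnorm_star -cnorm_starM starK.
by have := cnorm_ge0 (Z s k); nra.
Qed.

End CrystalRows.

Section CrystalBound.
Context {R : realType} {n : nat}.

(** Transposition exchanges rows with columns and upper with lower entries, so
    bounds on the lower triangle give bounds on the upper one. *)
Lemma crystal_transpose (B : cstarAlgType R) (b : 'I_n.+1 * 'I_n.+1 -> B) :
  crystal_relations b -> crystal_relations (fun ij => b (ij.2, ij.1)).
Proof.
case=> row col comm zero mcomm brack det lower upper diag scomm; split=> /=.
- by move=> i j l; exact: col.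
- by move=> i j k; exact: row.
- move=> i j k l ik jl; apply/eqP; rewrite subr_eq0 eq_sym -subr_eq0.
  by apply/eqP/comm.
- move=> i j k l ik jl; rewrite maxnC minnC => h.
  by rewrite -(zero j i l k) //; apply/eqP; rewrite eq_sym -subr_eq0 comm.
- by move=> i j k l ik jl; rewrite maxnC minnC; exact: mcomm.
- move=> i j k l ik jl; rewrite maxnC minnC => h.
  by rewrite brack //; apply/eqP; rewrite -subr_eq0 comm.
- exact: det.
- by move=> r s; exact: upper.
- by move=> r s; exact: lower.
- by move=> s; exact: diag.
- by move=> i j r s ir js; exact: scomm.
Qed.

Lemma crystal_lower_le1 (B : cstarAlgType R) (b : 'I_n.+1 * 'I_n.+1 -> B) :
  crystal_relations b -> forall s k : 'I_n.+1, (k <= s)%N ->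
  cnorm (b (s, k)) <= 1.
Proof.
case=> _ col comm _ mcomm brack det lower _ diag _ s k ks.
pose Z i j := b (inord i, inord j).
have ZE (i j : 'I_n.+1) : b (i, j) = Z i j by rewrite /Z !inord_val.
have prod_lt m : (m <= n.+1)%N ->
    \prod_(t < n.+1 | (t < m)%N) b (t, t) = \prod_(0 <= t < m) Z t t.
  move=> mn; rewrite (big_nat_widen _ _ _ _ _ mn) big_mkord.
  by apply: eq_bigr => t _; rewrite ZE.
have prod_gt m :
    \prod_(t < n.+1 | (m < t)%N) b (t, t) = \prod_(m.+1 <= t < n.+1) Z t t.
  rewrite (big_nat_widenl _ _ _ _ _ (leq0n _)) big_mkord.
  by apply: eq_bigr => t _; rewrite ZE.
rewrite ZE; apply: (@row_le1 _ _ n.+1 Z _ _ _ _ _ _ s (ltn_ord s) k ks).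
- move=> i j l /andP[ij jn] ln; apply: col; rewrite !inordK //; lia.
- move=> i j l m /andP[il ln] /andP[jm mn]; apply/eqP; rewrite -subr_eq0.
  by apply/eqP/comm; rewrite !inordK //; lia.
- move=> i j l m /andP[il ln] /andP[jm mn] h; apply/eqP; rewrite -subr_eq0.
  by apply/eqP/mcomm; rewrite !inordK //; lia.
- move=> i j l m /andP[il ln] /andP[jm mn] h; apply/eqP.
  rewrite addrC -subr_eq; apply/eqP/brack; rewrite !inordK //; lia.
- by rewrite big_mkord -[RHS]det; apply: eq_bigr => t _; rewrite ZE.
move=> r c /andP[cr rn].
have cn : (c < n.+1)%N by lia.
have Er := inordK rn; have Ec := inordK cn.
move: cr; rewrite leq_eqVlt => /orP[/eqP cr|cr].
  rewrite cr in Ec *; rewrite diag Er prod_lt ?prod_gt ?(ltnW rn) //.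
  by rewrite (big_geq (leqnn r)) mulr1.
by rewrite lower Er Ec // prod_lt ?prod_gt ?(ltnW cn).
Qed.

Lemma crystal_le1 (B : cstarAlgType R) (b : 'I_n.+1 * 'I_n.+1 -> B) :
  crystal_relations b -> forall ij, cnorm (b ij) <= 1.
Proof.
move=> bP [i j]; have [ji|/ltnW ij] := leqP j i; first exact: crystal_lower_le1.
exact: (crystal_lower_le1 (crystal_transpose bP)).
Qed.

(** Every relation is an equation between *-polynomials in the generators. *)
Lemma crystal_separated (A : cstarAlgType R) (z : 'I_n.+1 * 'I_n.+1 -> A) :
  (forall x y : A,
     (forall (B : cstarAlgType R) (phi : A -> B), unital_star_hom phi ->
        crystal_relations (phi \o z) -> phi x = phi y) -> x = y) ->
  crystal_relations z.
Proof.
move=> sep.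
have homP (B : cstarAlgType R) (phi : A -> B) (hphi : unital_star_hom phi) :=
  big_morph phi (homM hphi) (hom1 hphi).
split.
- move=> i j l jl; apply: sep => B phi hphi bP.
  by rewrite (homM hphi) (hom0 hphi); exact: (crystal_row bP).
- move=> i j k ik; apply: sep => B phi hphi bP.
  by rewrite (homM hphi) (hom0 hphi); exact: (crystal_col bP).
- move=> i j k l ik jl; apply: sep => B phi hphi bP.
  by rewrite (homB hphi) !(homM hphi) (hom0 hphi);
    exact: (crystal_anti_comm bP ik jl).
- move=> i j k l ik jl h; apply: sep => B phi hphi bP.
  by rewrite (homM hphi) (hom0 hphi); exact: (crystal_anti_zero bP ik jl h).
- move=> i j k l ik jl h; apply: sep => B phi hphi bP.
  by rewrite (homB hphi) !(homM hphi) (hom0 hphi);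
    exact: (crystal_main_comm bP ik jl h).
- move=> i j k l ik jl h; apply: sep => B phi hphi bP.
  by rewrite (homB hphi) !(homM hphi);
    exact: (crystal_main_bracket bP ik jl h).
- apply: sep => B phi hphi bP.
  by rewrite (homP _ _ hphi) (hom1 hphi); exact: (crystal_det bP).
- move=> r s rs; apply: sep => B phi hphi bP.
  by rewrite (hom_star hphi) !(homM hphi) !(homP _ _ hphi);
    exact: (crystal_star_lower bP rs).
- move=> r s rs; apply: sep => B phi hphi bP.
  by rewrite (hom_star hphi) !(homM hphi) !(homP _ _ hphi);
    exact: (crystal_star_upper bP rs).
- move=> s; apply: sep => B phi hphi bP.
  by rewrite (hom_star hphi) !(homM hphi) !(homP _ _ hphi);
    exact: (crystal_star_diag bP s).
- move=> i j r s ir js; apply: sep => B phi hphi bP.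
  by rewrite !(homM hphi) (hom_star hphi); exact: (crystal_star_comm bP ir js).
Qed.

End CrystalBound.

Theorem theorem2p3p1 (R : realType) (n : nat) (hn : (1 <= n)%N) :
  exists (A : cstarAlgType R) (z : 'I_n.+1 * 'I_n.+1 -> A),
    universal_cstar_algebra (@crystal_relations R n) z.
Proof.
apply: (@universal_cstar_algebra_exists _ _ _ (fun=> 1)).
- by move=> B b; exact: crystal_le1.
- exact: crystal_separated.
Qed.
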